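(* $$\sum_{k=0}^\infty \frac{H_{3k+1}-H_k}{(3k+1)\binom{3k}{k}\,2^{k+1}}=\frac{\pi^2}{48}-\frac{\ln^2 2}{10}+\frac25\,G.$$
   Context: $H_n=\sum_{k=1}^n \frac1k$ with $H_0=0$; $G=\sum_{j=0}^\infty \frac{(-1)^j}{(1+2j)^2}$ is Catalan's constant; $\ln^2 2=(\ln 2)^2$. *)

(* Defs.v *)
(* Stdlib reals with Coquelicot. *)
From Stdlib Require Import Reals.
From Coquelicot Require Import Coquelicot.
Open Scope R_scope.

(* The sum over the empty range 1..0 is zero, so [harmonic 0 = 0]. *)
Definition harmonic (n : nat) : R := sum_n_m (fun k : nat => 1 / INR k) 1 n.

Definition Catalan : R :=
  Series (fun j : nat => (-1) ^ j / (1 + 2 * INR j) ^ 2).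

(* Main.v *)
(* The Beta integral and its derivative in the first parameter give
   [(H_{3k+1} - H_k) / ((3k+1) C(3k,k)) = - int_0^1 ln x (x (1-x)^2)^k dx],
   so summing the geometric series turns the left-hand side into
   [- int_0^1 ln x / (2 - x (1-x)^2) dx], whose denominator factors as
   [(2 - x) (1 + x^2)].  Partial fractions leave [Li_2(1/2)], [eta(2)] and
   Catalan's constant, where [eta(2) = sum (-1)^n / (n+1)^2].  Landen's identity
   gives [Li_2(1/2) = eta(2) - ln^2 2 / 2], and [zeta(2)] follows Matsuoka: the
   ratio of [int x^2 cos^(2n) x] to [int cos^(2n) x] over [[0, PI/2]]
   telescopes to the partial sums of [1 / n^2]. *)
Require Import Defs.
From Stdlib Require Import Reals Lra Lia Factorial.
From Coquelicot Require Import Coquelicot.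
Open Scope R_scope.

(** * Powers times the logarithm near 0 *)

Lemma ln_ge_1_minus_inv (x : R) : 0 < x -> 1 - / x <= ln x.
Proof.
  intros Hx.
  assert (Hi : 0 < / x) by now apply Rinv_0_lt_compat.
  pose proof (exp_ineq1_le (ln (/ x))) as H.
  rewrite exp_ln, ln_Rinv in H by assumption.
  lra.
Qed.

(** For [0 < u <= 1], multiplying [1 - / u <= ln u <= 0] by [u] gives [u - 1 <= u * ln u <= 0], so
    one factor [u] absorbs the logarithm. Negative [u] is included because limits and derivatives at
    0 are two-sided. *)
Lemma Rabs_pow_mul_ln_le (n : nat) (u : R) :
  Rabs u <= 1 -> Rabs (u ^ S n * ln u) <= Rabs u ^ n.
Proof.
  intros Hu.
  change (u ^ S n) with (u * u ^ n).
  rewrite (Rmult_comm u), Rmult_assoc, Rabs_mult, <- RPow_abs.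
  rewrite <- (Rmult_1_r (Rabs u ^ n)) at 2.
  apply Rmult_le_compat_l; [apply pow_le, Rabs_pos|].
  destruct (Rlt_or_le 0 u) as [Hp|Hn].
  - rewrite Rabs_pos_eq in Hu by lra.
    assert (H1 : ln u <= 0) by (rewrite <- ln_1; apply ln_le; lra).
    pose proof (ln_ge_1_minus_inv u Hp) as H2.
    apply (Rmult_le_compat_l u) in H2; [|lra].
    rewrite Rmult_minus_distr_l, Rinv_r in H2 by lra.
    apply Rabs_le; nra.
  (* Outside the positive reals [ln] takes the default value 0. *)
  - unfold ln; destruct (Rlt_dec 0 u); [exfalso; lra|].
    rewrite Rmult_0_r, Rabs_R0; lra.
Qed.

(** The point 0 is included so that the fundamental theorem applies on all of [0, 1]. There the
    difference quotient is [h ^ (n + 2) * ln h], and the exponent leaves a spare factor: it is at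
    most [Rabs h] in absolute value. *)
Lemma is_derive_pow_mul_ln (n : nat) (u : R) : 0 <= u ->
  is_derive (fun v => v ^ (n + 3) * ln v) u
    (INR (n + 3) * (u ^ (n + 2) * ln u) + u ^ (n + 2)).
Proof.
  intros [Hu | <-].
  - auto_derive; [assumption|].
    replace (n + 3)%nat with (S (n + 2)) by lia.
    simpl pred; rewrite <- tech_pow_Rmult; field; lra.
  - replace (n + 3)%nat with (S (S (S n))) by lia.
    replace (n + 2)%nat with (S (S n)) by lia.
    rewrite !pow_ne_zero by lia.
    replace (_ * _ + _) with 0 by ring.
    apply is_derive_Reals; intros eps Heps.
    assert (Hd : 0 < Rmin 1 eps) by (apply Rmin_pos; lra).
    exists (mkposreal _ Hd); intros h Hh0 Hh; simpl in Hh.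
    assert (Hh1 : Rabs h < 1) by (eapply Rlt_le_trans; [exact Hh|apply Rmin_l]).
    assert (Hhe : Rabs h < eps) by (eapply Rlt_le_trans; [exact Hh|apply Rmin_r]).
    rewrite Rplus_0_l, (pow_ne_zero (S (S (S n)))) by lia.
    replace ((h ^ S (S (S n)) * ln h - 0 * ln 0) / h - 0)
      with (h ^ S (S n) * ln h) by (simpl; field; assumption).
    eapply Rle_lt_trans; [apply Rabs_pow_mul_ln_le; lra|].
    simpl.
    eapply Rle_lt_trans; [|exact Hhe].
    rewrite <- Rmult_1_r; apply Rmult_le_compat_l; [apply Rabs_pos|].
    rewrite <- (pow1 n); apply pow_incr; split; [apply Rabs_pos|lra].
Qed.

Lemma continuous_pow_mul_ln (n : nat) (u : R) : 0 <= u ->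
  continuous (fun v => v ^ (n + 2) * ln v) u.
Proof.
  intros [Hu | <-].
  - apply (ex_derive_continuous (V := R_NormedModule)); auto_derive; assumption.
  - apply filterlim_locally; intros eps.
    assert (Hd : 0 < Rmin 1 eps) by (apply Rmin_pos; [lra|apply cond_pos]).
    exists (mkposreal _ Hd); intros h Hh.
    change (Rabs (h - 0) < Rmin 1 eps) in Hh.
    change (Rabs (h ^ (n + 2) * ln h - 0 ^ (n + 2) * ln 0) < eps).
    rewrite Rminus_0_r in Hh.
    assert (Hh1 : Rabs h < 1) by (eapply Rlt_le_trans; [exact Hh|apply Rmin_l]).
    assert (Hhe : Rabs h < eps) by (eapply Rlt_le_trans; [exact Hh|apply Rmin_r]).
    rewrite (pow_ne_zero (n + 2)) by lia.
    rewrite Rmult_0_l, Rminus_0_r.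
    replace (n + 2)%nat with (S (S n)) by lia.
    eapply Rle_lt_trans; [apply Rabs_pow_mul_ln_le; lra|].
    simpl.
    eapply Rle_lt_trans; [|exact Hhe].
    rewrite <- Rmult_1_r; apply Rmult_le_compat_l; [apply Rabs_pos|].
    rewrite <- (pow1 n); apply pow_incr; split; [apply Rabs_pos|lra].
Qed.

(** * The logarithmic integral as a positive linear functional *)

Definition continuous_on_unit (f : R -> R) : Prop :=
  forall x, 0 <= x <= 1 -> continuous f x.

(* The functional [f |-> - int_0^1 ln x f(x) dx], written after the
   substitution [x = u^3], which makes the integrand continuous at [0]. *)
Definition log_integrand (f : R -> R) (u : R) : R :=
  -9 * (u ^ 2 * ln u) * f (u ^ 3).

Definition log_integral (f : R -> R) : R := RInt (log_integrand f) 0 1.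

Lemma cube_unit (u : R) : 0 <= u <= 1 -> 0 <= u ^ 3 <= 1.
Proof.
  intros Hu; split; [apply pow_le; lra|].
  rewrite <- (pow1 3); apply pow_incr; lra.
Qed.

(** With [x = u^3], [- ln x dx] becomes [- (3 ln u) (3 u^2) du], whence the constant 9. The sign of
    this weight makes [log_integral] monotone. *)
Lemma log_weight_nonneg (u : R) : 0 < u < 1 -> 0 <= -9 * (u ^ 2 * ln u).
Proof.
  intros Hu.
  assert (ln u < 0) by (rewrite <- ln_1; apply ln_increasing; lra).
  nra.
Qed.

Lemma ex_RInt_log_integrand (f : R -> R) :
  continuous_on_unit f -> ex_RInt (log_integrand f) 0 1.
Proof.
  intros Hf; apply (ex_RInt_continuous (V := R_CompleteNormedModule)); intros u.
  rewrite Rmin_left, Rmax_right by lra; intros Hu.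
  unfold log_integrand.
  apply (continuous_mult (fun u => -9 * (u ^ 2 * ln u)) (fun u => f (u ^ 3))).
  - apply (continuous_scal_r (-9) (fun u => u ^ 2 * ln u)).
    apply (continuous_pow_mul_ln 0); lra.
  - apply (continuous_comp (fun u => u ^ 3) f).
    + apply (ex_derive_continuous (V := R_NormedModule)); auto_derive; trivial.
    + apply Hf, cube_unit, Hu.
Qed.

Lemma log_integral_ext (f g : R -> R) :
  (forall x, 0 <= x <= 1 -> f x = g x) -> log_integral f = log_integral g.
Proof.
  intros Hfg; apply (RInt_ext (V := R_CompleteNormedModule)); intros u.
  rewrite Rmin_left, Rmax_right by lra; intros Hu.
  unfold log_integrand; rewrite Hfg; [reflexivity|apply cube_unit; lra].
Qed.

Lemma log_integral_plus (f g : R -> R) :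
  continuous_on_unit f -> continuous_on_unit g ->
  log_integral (fun x => f x + g x) = log_integral f + log_integral g.
Proof.
  intros Hf Hg; unfold log_integral.
  rewrite <- (RInt_plus (V := R_CompleteNormedModule))
    by now apply ex_RInt_log_integrand.
  apply (RInt_ext (V := R_CompleteNormedModule)); intros u _.
  unfold log_integrand, plus; simpl; ring.
Qed.

Lemma log_integral_scal (c : R) (f : R -> R) :
  continuous_on_unit f -> log_integral (fun x => c * f x) = c * log_integral f.
Proof.
  intros Hf; unfold log_integral.
  rewrite <- (RInt_scal (V := R_CompleteNormedModule))
    by now apply ex_RInt_log_integrand.
  apply (RInt_ext (V := R_CompleteNormedModule)); intros u _.
  unfold log_integrand, scal; simpl; unfold mult; simpl; ring.
Qed.

Lemma log_integral_le (f g : R -> R) :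
  continuous_on_unit f -> continuous_on_unit g ->
  (forall x, 0 <= x <= 1 -> f x <= g x) -> log_integral f <= log_integral g.
Proof.
  intros Hf Hg Hfg; apply RInt_le; [lra|now apply ex_RInt_log_integrand..|].
  intros u Hu; apply Rmult_le_compat_l; [now apply log_weight_nonneg|].
  apply Hfg, cube_unit; lra.
Qed.

Lemma continuous_on_unit_plus (f g : R -> R) :
  continuous_on_unit f -> continuous_on_unit g ->
  continuous_on_unit (fun x => f x + g x).
Proof.
  intros Hf Hg x Hx; apply (continuous_plus f g); [apply Hf|apply Hg]; exact Hx.
Qed.

Lemma continuous_on_unit_mult (f g : R -> R) :
  continuous_on_unit f -> continuous_on_unit g ->
  continuous_on_unit (fun x => f x * g x).
Proof.
  intros Hf Hg x Hx; apply (continuous_mult f g); [apply Hf|apply Hg]; exact Hx.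
Qed.

Lemma continuous_on_unit_const (c : R) : continuous_on_unit (fun _ => c).
Proof. intros x _; apply continuous_const. Qed.

Lemma continuous_on_unit_pow (f : R -> R) (n : nat) :
  continuous_on_unit f -> continuous_on_unit (fun x => f x ^ n).
Proof.
  intros Hf; induction n as [|n IH]; simpl.
  - apply continuous_on_unit_const.
  - now apply continuous_on_unit_mult.
Qed.

Lemma continuous_on_unit_ex_derive (f : R -> R) :
  (forall x, 0 <= x <= 1 -> ex_derive f x) -> continuous_on_unit f.
Proof.
  intros H x Hx; apply (ex_derive_continuous (V := R_NormedModule)), H, Hx.
Qed.

Lemma continuous_on_unit_sum_n (g : nat -> R -> R) (N : nat) :
  (forall n, continuous_on_unit (g n)) ->
  continuous_on_unit (fun x => sum_n (fun n => g n x) N).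
Proof.
  intros Hg; induction N as [|N IH]; intros x Hx.
  - apply continuous_ext with (g O); [intros y; now rewrite sum_O|now apply Hg].
  - apply continuous_ext with (fun y => sum_n (fun n => g n y) N + g (S N) y);
      [intros y; now rewrite sum_Sn|].
    now apply continuous_on_unit_plus.
Qed.

Lemma log_integral_sum_n (g : nat -> R -> R) (N : nat) :
  (forall n, continuous_on_unit (g n)) ->
  log_integral (fun x => sum_n (fun n => g n x) N)
  = sum_n (fun n => log_integral (g n)) N.
Proof.
  intros Hg; induction N as [|N IH].
  - rewrite sum_O; apply log_integral_ext; intros x _; now rewrite sum_O.
  - rewrite sum_Sn, <- IH; unfold plus; simpl.
    rewrite <- log_integral_plus by (try apply continuous_on_unit_sum_n; auto).
    apply log_integral_ext; intros x _; now rewrite sum_Sn.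
Qed.

(** * Termwise integration of geometric series *)

Lemma sum_n_geometric (c r : R) (N : nat) : 1 - r <> 0 ->
  sum_n (fun n => c * r ^ n) N = c / (1 - r) - c / (1 - r) * r ^ S N.
Proof.
  intros Hr; induction N as [|N IH].
  - rewrite sum_O; simpl; field; exact Hr.
  - rewrite sum_Sn, IH; unfold plus; simpl; field; exact Hr.
Qed.

(** The error after the terms 0 to N is the functional at [c / (1 - r) * r ^ S N], which is squeezed
    between plus and minus its value at [q ^ S N]. Convergence need not be uniform: [q] may reach 1
    at an endpoint, as long as the integrals of its powers vanish. *)
Lemma is_series_log_integral_geometric (c r q : R -> R) :
  continuous_on_unit c -> continuous_on_unit r -> continuous_on_unit q ->
  (forall x, 0 <= x <= 1 -> 0 < 1 - r x) ->
  (forall x, 0 <= x <= 1 -> Rabs (c x / (1 - r x)) <= 1) ->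
  (forall x, 0 <= x <= 1 -> Rabs (r x) <= q x) ->
  is_lim_seq (fun n => log_integral (fun x => q x ^ n)) 0 ->
  is_series (fun n => log_integral (fun x => c x * r x ^ n))
    (log_integral (fun x => c x / (1 - r x))).
Proof.
  intros Hc Hr Hq Hr1 Hcr Hrq Hlim.
  assert (Hg : forall n, continuous_on_unit (fun x => c x * r x ^ n)).
  { intros n; apply continuous_on_unit_mult; [exact Hc|].
    now apply continuous_on_unit_pow. }
  assert (Hf : continuous_on_unit (fun x => c x / (1 - r x))).
  { intros x Hx; apply (continuous_mult c (fun x => / (1 - r x))); [now apply Hc|].
    apply (continuous_comp (fun x => 1 - r x) Rinv).
    - apply (continuous_minus (fun _ => 1) r); [apply continuous_const|now apply Hr].
    - apply continuous_Rinv; specialize (Hr1 x Hx); lra. }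
  assert (Hq' : forall n, continuous_on_unit (fun x => q x ^ n))
    by (intros n; now apply continuous_on_unit_pow).
  assert (Hq1 : forall n, continuous_on_unit (fun x => -1 * q x ^ n))
    by (intros n; apply continuous_on_unit_mult;
        [apply continuous_on_unit_const|apply Hq']).
  (* The remainder after index [N] carries the power [S N], so the vanishing bound is shifted by
     one. *)
  apply is_lim_seq_incr_1 in Hlim; rename Hlim into Hlim1.
  set (l := log_integral (fun x => c x / (1 - r x))) in *.
  change (is_lim_seq (sum_n (fun n => log_integral (fun x => c x * r x ^ n))) l).
  assert (Hb : forall N x, 0 <= x <= 1 ->
    Rabs (c x / (1 - r x) * r x ^ S N) <= q x ^ S N).
  { intros N x Hx; rewrite Rabs_mult, <- RPow_abs, <- (Rmult_1_l (q x ^ S N)).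
    apply Rmult_le_compat; [apply Rabs_pos|apply pow_le, Rabs_pos|now apply Hcr|].
    apply pow_incr; split; [apply Rabs_pos|now apply Hrq]. }
  apply is_lim_seq_le_le with
    (u := fun N => l - log_integral (fun x => q x ^ S N))
    (w := fun N => l + log_integral (fun x => q x ^ S N)).
  - intros N; rewrite <- (log_integral_sum_n (fun n x => c x * r x ^ n)) by exact Hg.
    assert (Hs : forall x, 0 <= x <= 1 -> sum_n (fun n => c x * r x ^ n) N
      = c x / (1 - r x) - c x / (1 - r x) * r x ^ S N).
    { intros x Hx; apply sum_n_geometric; specialize (Hr1 x Hx); lra. }
    split.
    + replace (l - log_integral (fun x => q x ^ S N))
        with (l + -1 * log_integral (fun x => q x ^ S N)) by ring.
      unfold l; rewrite <- log_integral_scal by apply Hq'.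
      rewrite <- log_integral_plus by auto.
      apply log_integral_le; [now apply continuous_on_unit_plus
        |now apply (continuous_on_unit_sum_n (fun n x => c x * r x ^ n))|].
      intros x Hx; rewrite Hs by exact Hx.
      pose proof (Rle_abs (c x / (1 - r x) * r x ^ S N)).
      specialize (Hb N x Hx). lra.
    + unfold l; rewrite <- log_integral_plus by auto.
      apply log_integral_le;
        [now apply (continuous_on_unit_sum_n (fun n x => c x * r x ^ n))
        |now apply continuous_on_unit_plus|].
      intros x Hx; rewrite Hs by exact Hx.
      pose proof (Rle_abs (- (c x / (1 - r x) * r x ^ S N))) as Ha.
      rewrite Rabs_Ropp in Ha.
      specialize (Hb N x Hx). lra.
  - evar_last; [apply is_lim_seq_minus'; [apply is_lim_seq_const|exact Hlim1]|].
    simpl; f_equal; ring.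
  - evar_last; [apply is_lim_seq_plus'; [apply is_lim_seq_const|exact Hlim1]|].
    simpl; f_equal; ring.
Qed.

(** * Moments and Beta integrals *)

Lemma log_integral_pow (n : nat) :
  log_integral (fun x => x ^ n) = / (INR n + 1) ^ 2.
Proof.
  pose proof (pos_INR n) as Hn.
  set (m := (3 * n)%nat).
  assert (Hm : INR (m + 3) = 3 * (INR n + 1))
    by (unfold m; rewrite plus_INR, mult_INR; simpl; ring).
  (* Integration by parts of [-9 * u ^ (m + 2) * ln u] gives this antiderivative. It vanishes at 0,
     and at 1 only [9 / INR (m + 3) ^ 2] survives, where [INR (m + 3) = 3 * (INR n + 1)]. *)
  replace (/ (INR n + 1) ^ 2) with
    (minus (-9 / INR (m + 3) * (1 ^ (m + 3) * ln 1) + 9 / INR (m + 3) ^ 2 * 1 ^ (m + 3))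
       (-9 / INR (m + 3) * (0 ^ (m + 3) * ln 0) + 9 / INR (m + 3) ^ 2 * 0 ^ (m + 3))).
  - apply is_RInt_unique.
    assert (Hext : forall u, -9 * (u ^ (m + 2) * ln u) = log_integrand (fun x => x ^ n) u).
    { intros u; unfold log_integrand, m; rewrite <- pow_mult, pow_add; ring. }
    apply is_RInt_ext with (1 := fun u _ => Hext u).
    apply (is_RInt_derive (V := R_CompleteNormedModule)
      (fun u => -9 / INR (m + 3) * (u ^ (m + 3) * ln u)
                + 9 / INR (m + 3) ^ 2 * u ^ (m + 3)));
      intros u; rewrite Rmin_left, Rmax_right by lra; intros Hu.
    + evar_last.
      * apply (is_derive_plus (V := R_NormedModule)).
        -- apply is_derive_scal, is_derive_pow_mul_ln; lra.
        -- apply is_derive_scal; auto_derive; [trivial|reflexivity].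
      * replace (pred (m + 3)) with (m + 2)%nat by lia.
        unfold plus; simpl; rewrite Hm; field; lra.
    + apply (continuous_scal_r (-9) (fun u => u ^ (m + 2) * ln u)).
      apply continuous_pow_mul_ln; lra.
  - rewrite pow1, ln_1, pow_ne_zero, Hm by lia.
    unfold minus, plus, opp; simpl; field; lra.
Qed.

Lemma harmonic_S (n : nat) : harmonic (S n) = harmonic n + / (INR n + 1).
Proof.
  unfold harmonic; rewrite sum_n_Sm, S_INR by lia.
  unfold plus; simpl; f_equal; apply Rmult_1_l.
Qed.

(** Differentiation in a parameter is replaced by induction on [b], through [x^a (1-x)^(b+1) = x^a
    (1-x)^b - x^(a+1) (1-x)^b]. The second term raises [a], so [a] is generalized. *)
Lemma log_integral_beta (a b : nat) :
  log_integral (fun x => x ^ a * (1 - x) ^ b)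
  = INR (fact a) * INR (fact b) / INR (fact (a + b + 1))
    * (harmonic (a + b + 1) - harmonic a).
Proof.
  assert (Hmono : forall i j, continuous_on_unit (fun x => x ^ i * (1 - x) ^ j)).
  { intros i j; apply continuous_on_unit_ex_derive; intros x _.
    auto_derive; trivial. }
  revert a; induction b as [|b IH]; intros a.
  - rewrite (log_integral_ext _ (fun x => x ^ a)) by (intros x _; simpl; ring).
    rewrite log_integral_pow.
    replace (a + 0 + 1)%nat with (S a) by lia.
    rewrite harmonic_S, fact_simpl, mult_INR, S_INR.
    pose proof (pos_INR a); pose proof (INR_fact_neq_0 a).
    simpl (INR (fact 0)); field; split; lra.
  - rewrite (log_integral_ext _
      (fun x => x ^ a * (1 - x) ^ b + -1 * (x ^ S a * (1 - x) ^ b)))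
      by (intros x _; simpl; ring).
    rewrite log_integral_plus;
      [|apply Hmono|apply continuous_on_unit_mult;
                    [apply continuous_on_unit_const|apply Hmono]].
    rewrite log_integral_scal by apply Hmono.
    rewrite (IH a), (IH (S a)).
    replace (S a + b + 1)%nat with (S (a + b + 1)) by lia.
    replace (a + S b + 1)%nat with (S (a + b + 1)) by lia.
    rewrite !harmonic_S, !fact_simpl, !mult_INR, !S_INR, !plus_INR.
    pose proof (pos_INR a); pose proof (pos_INR b).
    pose proof (INR_fact_neq_0 a); pose proof (INR_fact_neq_0 b).
    pose proof (INR_fact_neq_0 (a + b + 1)).
    simpl (INR 1); field; repeat split; lra.
Qed.

(** * Wallis integrals, zeta(2) and eta(2) *)

Definition wallis (n : nat) : R := RInt (fun x => cos x ^ (2 * n)) 0 (PI / 2).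

Definition wallis_sqr (n : nat) : R :=
  RInt (fun x => x ^ 2 * cos x ^ (2 * n)) 0 (PI / 2).

Lemma ex_RInt_wallis (n : nat) : ex_RInt (fun x => cos x ^ (2 * n)) 0 (PI / 2).
Proof.
  apply (ex_RInt_continuous (V := R_CompleteNormedModule)); intros x _.
  apply (ex_derive_continuous (V := R_NormedModule)); auto_derive; trivial.
Qed.

Lemma ex_RInt_wallis_sqr (n : nat) :
  ex_RInt (fun x => x ^ 2 * cos x ^ (2 * n)) 0 (PI / 2).
Proof.
  apply (ex_RInt_continuous (V := R_CompleteNormedModule)); intros x _.
  apply (ex_derive_continuous (V := R_NormedModule)); auto_derive; trivial.
Qed.

Lemma RInt_of_derive (F f : R -> R) (a b : R) :
  (forall x, is_derive F x (f x)) -> (forall x, ex_derive f x) ->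
  RInt f a b = F b - F a.
Proof.
  intros HF Hf; apply is_RInt_unique, (is_RInt_derive (V := R_CompleteNormedModule)).
  - intros x _; apply HF.
  - intros x _; apply (ex_derive_continuous (V := R_NormedModule)), Hf.
Qed.

Lemma RInt_lincomb (f g : R -> R) (p q a b : R) :
  ex_RInt f a b -> ex_RInt g a b ->
  RInt (fun x => p * f x + q * g x) a b = p * RInt f a b + q * RInt g a b.
Proof.
  intros Hf Hg.
  change (RInt (fun x => plus (scal p (f x)) (scal q (g x))) a b
          = p * RInt f a b + q * RInt g a b).
  rewrite (RInt_plus (V := R_CompleteNormedModule))
    by (now apply (ex_RInt_scal (V := R_NormedModule))).
  now rewrite !(RInt_scal (V := R_CompleteNormedModule)) by assumption.
Qed.

Lemma sin_sqr (x : R) : sin x ^ 2 = 1 - cos x ^ 2.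
Proof. pose proof (sin2_cos2 x) as H; unfold Rsqr in H; lra. Qed.

Lemma wallis_S (n : nat) :
  (2 * INR n + 2) * wallis (S n) = (2 * INR n + 1) * wallis n.
Proof.
  assert (H : RInt (fun x => (2 * INR n + 2) * cos x ^ (2 * S n)
                             + - (2 * INR n + 1) * cos x ^ (2 * n)) 0 (PI / 2)
              = cos (PI / 2) ^ (2 * n + 1) * sin (PI / 2)
                - cos 0 ^ (2 * n + 1) * sin 0).
  (* This primitive vanishes at both endpoints; replacing [sin^2] by [1 - cos^2] in its derivative
     leaves only even powers of the cosine. *)
  { apply (RInt_of_derive (fun x => cos x ^ (2 * n + 1) * sin x));
      intros x; auto_derive; trivial.
    change (n + (n + 0))%nat with (2 * n)%nat.
    replace (pred (2 * n + 1)) with (2 * n)%nat by lia.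
    replace (2 * S n)%nat with (S (S (2 * n))) by lia.
    replace (2 * n + 1)%nat with (S (2 * n)) by lia.
    rewrite !S_INR, !mult_INR; simpl (INR 2).
    pose proof (sin_sqr x) as Hs; simpl in *.
    set (P := cos x ^ (n + (n + 0))) in *.
    transitivity (- (2 * INR n + 1) * P * (sin x * (sin x * 1)) + cos x * P * cos x);
      [ring|].
    rewrite Hs; ring. }
  rewrite RInt_lincomb in H by apply ex_RInt_wallis.
  rewrite cos_PI2, sin_0, pow_ne_zero in H by lia.
  unfold wallis; lra.
Qed.

Lemma wallis_sqr_S (n : nat) :
  wallis (S n) = (INR n + 1) * (2 * INR n + 1) * wallis_sqr n
                 - 2 * (INR n + 1) ^ 2 * wallis_sqr (S n).
Proof.
  assert (H : RInt (fun x => 1 * (1 * cos x ^ (2 * S n)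
                 + 2 * (INR n + 1) ^ 2 * (x ^ 2 * cos x ^ (2 * S n)))
               + - ((INR n + 1) * (2 * INR n + 1)) * (x ^ 2 * cos x ^ (2 * n)))
               0 (PI / 2)
      = (PI / 2 * cos (PI / 2) ^ (2 * n + 2)
         + (INR n + 1) * (PI / 2) ^ 2 * cos (PI / 2) ^ (2 * n + 1) * sin (PI / 2))
        - (0 * cos 0 ^ (2 * n + 2)
           + (INR n + 1) * 0 ^ 2 * cos 0 ^ (2 * n + 1) * sin 0)).
  (* The primitive comes from integrating [cos^(2n+2)] by parts twice. The terms in
     [x cos^(2n+1) sin] cancel in its derivative, and it vanishes at both endpoints. *)
  { apply (RInt_of_derive (fun x => x * cos x ^ (2 * n + 2)
        + (INR n + 1) * x ^ 2 * cos x ^ (2 * n + 1) * sin x));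
      intros x; auto_derive; trivial.
    change (n + (n + 0))%nat with (2 * n)%nat.
    replace (pred (2 * n + 2)) with (S (2 * n)) by lia.
    change (n + (n + 0))%nat with (2 * n)%nat.
    replace (pred (2 * n + 1)) with (2 * n)%nat by lia.
    replace (2 * S n)%nat with (S (S (2 * n))) by lia.
    replace (2 * n + 2)%nat with (S (S (2 * n))) by lia.
    replace (2 * n + 1)%nat with (S (2 * n)) by lia.
    rewrite !S_INR, !mult_INR; simpl (INR 2).
    pose proof (sin_sqr x) as Hs; simpl in *.
    set (P := cos x ^ (n + (n + 0))) in *.
    transitivity (cos x * cos x * P + (INR n + 1) * x ^ 2 * cos x * cos x * P
      - (INR n + 1) * x ^ 2 * (2 * INR n + 1) * P * (sin x * (sin x * 1))); [ring|].
    rewrite Hs; ring. }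
  rewrite (RInt_lincomb (fun x => 1 * cos x ^ (2 * S n)
      + 2 * (INR n + 1) ^ 2 * (x ^ 2 * cos x ^ (2 * S n)))
      (fun x => x ^ 2 * cos x ^ (2 * n))) in H.
  2: { apply (ex_RInt_plus (V := R_NormedModule));
       apply (ex_RInt_scal (V := R_NormedModule));
       [apply ex_RInt_wallis|apply ex_RInt_wallis_sqr]. }
  2: apply ex_RInt_wallis_sqr.
  rewrite (RInt_lincomb (fun x => cos x ^ (2 * S n))
      (fun x => x ^ 2 * cos x ^ (2 * S n))) in H.
  2: apply ex_RInt_wallis.
  2: apply ex_RInt_wallis_sqr.
  rewrite cos_PI2, !pow_ne_zero in H by lia.
  unfold wallis, wallis_sqr; lra.
Qed.

Lemma wallis_0 : wallis 0 = PI / 2.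
Proof.
  unfold wallis; rewrite (RInt_of_derive (fun x => x)).
  - lra.
  - intros x; auto_derive; trivial.
  - intros x; auto_derive; trivial.
Qed.

Lemma wallis_sqr_0 : wallis_sqr 0 = PI ^ 3 / 24.
Proof.
  unfold wallis_sqr; rewrite (RInt_of_derive (fun x => x ^ 3 / 3)).
  - simpl; field.
  - intros x; auto_derive; trivial; simpl; field.
  - intros x; auto_derive; trivial.
Qed.

Lemma wallis_pos (n : nat) : 0 < wallis n.
Proof.
  pose proof PI_RGT_0.
  apply RInt_gt_0; [lra| |].
  - intros x Hx; apply pow_lt, cos_gt_0; lra.
  - intros x _; apply (ex_derive_continuous (V := R_NormedModule)).
    auto_derive; trivial.
Qed.

(** The derivative of [sin t - t cos t] is [t sin t], nonnegative on this range. It is the bound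
    [x <= tan x] in a form that stays meaningful at [PI / 2]. *)
Lemma x_cos_le_sin (x : R) : 0 <= x <= PI -> x * cos x <= sin x.
Proof.
  intros Hx.
  destruct (MVT_gen (fun t => sin t - t * cos t) 0 x (fun t => t * sin t))
    as [c [Hc Heq]].
  - intros t _; auto_derive; trivial; ring.
  - intros t _; apply derivable_continuous_pt, ex_derive_Reals_0.
    auto_derive; trivial.
  - rewrite Rmin_left, Rmax_right in Hc by lra.
    assert (0 <= sin c) by (apply sin_ge_0; lra).
    rewrite sin_0 in Heq.
    assert (0 <= c * sin c * (x - 0)) by (repeat apply Rmult_le_pos; lra).
    lra.
Qed.

(** Squaring [x cos x <= sin x] and multiplying by [cos^(2n)] gives
    [x^2 cos^(2n+2) <= cos^(2n) - cos^(2n+2)] pointwise. *)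
Lemma wallis_sqr_S_le (n : nat) :
  0 <= wallis_sqr (S n) <= wallis n - wallis (S n).
Proof.
  pose proof PI_RGT_0 as HPI.
  split.
  - replace 0 with (RInt (fun _ => 0) 0 (PI / 2)).
    + apply RInt_le; [lra|apply ex_RInt_const|apply ex_RInt_wallis_sqr|].
      intros x Hx; apply Rmult_le_pos; [apply pow_le; lra|].
      apply pow_le, cos_ge_0; lra.
    + rewrite (RInt_const (V := R_CompleteNormedModule)).
      unfold scal; simpl; unfold mult; simpl; ring.
  - replace (wallis n - wallis (S n)) with (1 * wallis n + (-1) * wallis (S n)) by ring.
    unfold wallis; rewrite <- RInt_lincomb by apply ex_RInt_wallis.
    apply RInt_le; [lra|apply ex_RInt_wallis_sqr| |].
    + apply (ex_RInt_plus (V := R_NormedModule));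
       apply (ex_RInt_scal (V := R_NormedModule)); apply ex_RInt_wallis.
    + intros x Hx.
      pose proof (x_cos_le_sin x ltac:(lra)) as Hxs.
      assert (0 <= cos x) by (apply cos_ge_0; lra).
      assert (Hsq : (x * cos x) ^ 2 <= sin x ^ 2).
      { apply pow_incr; split; [apply Rmult_le_pos; lra|exact Hxs]. }
      rewrite sin_sqr in Hsq.
      assert (0 <= cos x ^ (2 * n)) by (apply pow_le; assumption).
      replace (2 * S n)%nat with (2 * n + 2)%nat by lia.
      rewrite !pow_add; nra.
Qed.

Lemma is_lim_seq_inv_INR_plus_1 : is_lim_seq (fun n => / (INR n + 1)) 0.
Proof.
  apply is_lim_seq_ext with (fun n => / INR (S n)); [intros n; now rewrite S_INR|].
  apply (is_lim_seq_incr_1 (fun n => / INR n)).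
  evar_last; [apply is_lim_seq_inv; [apply is_lim_seq_INR|discriminate]|reflexivity].
Qed.

Lemma basel_partial_sum (N : nat) :
  sum_n (fun n => / (INR n + 1) ^ 2) N
  = PI ^ 2 / 6 - 2 * (wallis_sqr (S N) / wallis (S N)).
Proof.
  (* Dividing [wallis_sqr_S] by [(n+1)^2 wallis (n+1)] and applying [wallis_S] to the first ratio
     makes the terms telescope. The initial term is [2 (PI^3 / 24) / (PI / 2) = PI^2 / 6]. *)
  assert (Hstep : forall n, / (INR n + 1) ^ 2
    = 2 * (wallis_sqr n / wallis n) - 2 * (wallis_sqr (S n) / wallis (S n))).
  { intros n.
    pose proof (wallis_pos n) as H0; pose proof (wallis_pos (S n)) as H1.
    pose proof (wallis_S n) as HS; pose proof (wallis_sqr_S n) as HJ.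
    pose proof (pos_INR n) as Hn.
    assert (E : wallis n = (2 * INR n + 2) * wallis (S n) / (2 * INR n + 1))
      by (rewrite HS; field; lra).
    assert (E' : wallis_sqr n
      = (wallis (S n) + 2 * (INR n + 1) ^ 2 * wallis_sqr (S n))
        / ((INR n + 1) * (2 * INR n + 1))) by (rewrite HJ; field; lra).
    rewrite E, E'; field; repeat split; lra. }
  induction N as [|N IH].
  - rewrite sum_O, Hstep, wallis_0, wallis_sqr_0.
    pose proof PI_RGT_0; pose proof (wallis_pos 1); simpl in *; field; lra.
  - rewrite sum_Sn, IH, Hstep; unfold plus; simpl; ring.
Qed.

Lemma basel : is_lim_seq (sum_n (fun n => / (INR n + 1) ^ 2)) (PI ^ 2 / 6).
Proof.
  apply is_lim_seq_le_le with
    (u := fun N => PI ^ 2 / 6 - 2 * / (INR N + 1)) (w := fun _ => PI ^ 2 / 6).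
  - intros N; rewrite basel_partial_sum.
    pose proof (wallis_pos N) as H0; pose proof (wallis_pos (S N)) as H1.
    pose proof (wallis_S N) as HS; pose proof (wallis_sqr_S_le N) as [HJ0 HJ].
    pose proof (pos_INR N) as HN.
    (* By [wallis_S], [wallis N - wallis (S N)] equals [wallis (S N) / (2 N + 1)], so the ratio is
       even at most [1 / (2 N + 1)]. *)
    assert (Hq : 0 <= wallis_sqr (S N) / wallis (S N) <= / (INR N + 1)).
    { split; [apply Rdiv_le_0_compat; lra|].
      apply Rmult_le_reg_r with (wallis (S N)); [lra|].
      unfold Rdiv; rewrite Rmult_assoc, Rinv_l, Rmult_1_r by lra.
      eapply Rle_trans; [exact HJ|].
      apply Rmult_le_reg_l with ((2 * INR N + 1) * (INR N + 1)); [nra|].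
      replace ((2 * INR N + 1) * (INR N + 1) * (/ (INR N + 1) * wallis (S N)))
        with ((2 * INR N + 1) * wallis (S N)) by (field; lra).
      assert (E : wallis N = (2 * INR N + 2) * wallis (S N) / (2 * INR N + 1))
        by (rewrite HS; field; lra).
      rewrite E.
      replace ((2 * INR N + 1) * (INR N + 1)
        * ((2 * INR N + 2) * wallis (S N) / (2 * INR N + 1) - wallis (S N)))
        with ((INR N + 1) * wallis (S N)) by (field; lra).
      nra. }
    lra.
  - evar_last; [apply is_lim_seq_minus'; [apply is_lim_seq_const|]|].
    + apply is_lim_seq_mult'; [apply is_lim_seq_const|].
      exact is_lim_seq_inv_INR_plus_1.
    + simpl; f_equal; ring.
  - apply is_lim_seq_const.
Qed.

(** The alternating sum is the full sum minus twice its terms with even denominators, and these form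
    a quarter of the sum up to [N]. Stopping at the odd index [2 * N + 1] makes this exact, and the
    limit is [PI^2/6 - PI^2/12]. *)
Lemma eta_2 :
  is_lim_seq (fun N => sum_n (fun n => (-1) ^ n / (INR n + 1) ^ 2) (2 * N + 1))
    (PI ^ 2 / 12).
Proof.
  apply is_lim_seq_ext with (fun N => sum_n (fun n => / (INR n + 1) ^ 2) (2 * N + 1)
     - 1 / 2 * sum_n (fun n => / (INR n + 1) ^ 2) N).
  - intros N; induction N as [|N IH].
    + simpl (2 * 0 + 1)%nat; rewrite !sum_Sn, !sum_O; unfold plus; simpl; field.
    + replace (2 * S N + 1)%nat with (S (S (2 * N + 1))) by lia.
      rewrite !sum_Sn, <- IH; unfold plus; simpl (AbelianMonoid.plus _ _).
      replace ((-1) ^ S (2 * N + 1)) with 1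
        by (replace (S (2 * N + 1)) with (2 * S N)%nat by lia; now rewrite pow_1_even).
      replace ((-1) ^ S (S (2 * N + 1))) with (-1)
        by (replace (S (S (2 * N + 1))) with (S (2 * S N))%nat by lia;
            now rewrite pow_1_odd).
      rewrite !S_INR, plus_INR, mult_INR; simpl (INR 2); simpl (INR 1).
      pose proof (pos_INR N); simpl; field; split; nra.
  - evar_last; [apply is_lim_seq_minus'|].
    + apply (is_lim_seq_subseq _ _ (fun N => (2 * N + 1)%nat)); [|exact basel].
      apply eventually_subseq; intros n; lia.
    + apply is_lim_seq_mult'; [apply is_lim_seq_const|exact basel].
    + simpl; f_equal; field.
Qed.

(** * Landen's identity with explicit truncation error *)

Definition log_remainder (N : nat) (y : R) : R :=
  - ln (1 - y) - sum_n (fun n => y ^ S n / (INR n + 1)) N.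

Lemma is_derive_log_remainder (N : nat) (y : R) : y < 1 ->
  is_derive (log_remainder N) y (y ^ S N / (1 - y)).
Proof.
  intros Hy; unfold log_remainder.
  replace (y ^ S N / (1 - y))
    with (minus (/ (1 - y)) (sum_n (fun n => 1 * y ^ n) N)).
  - apply (is_derive_minus (V := R_NormedModule)).
    + auto_derive; [lra|field; lra].
    + apply (is_derive_sum_n (V := R_NormedModule) (fun n y => y ^ S n / (INR n + 1))).
      intros k _; auto_derive; trivial.
      change (match k with O => 1 | S _ => INR k + 1 end) with (INR (S k)).
      pose proof (pos_INR k); rewrite S_INR; simpl (pred (S k)); field; lra.
  - rewrite sum_n_geometric by lra.
    unfold minus, plus, opp; simpl; field; lra.
Qed.

(** The mean value theorem from 0 gives [c ^ S N / (1 - c) * y] with [c] between 0 and [y], and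
    [1 - c >= 1/2]. The range of [y] covers both [-s] and [s / (1 + s)] for [s] in [0, 1]. *)
Lemma log_remainder_le (N : nat) (y : R) : -1 <= y <= 1 / 2 ->
  Rabs (log_remainder N y) <= 2 * Rabs y ^ S (S N).
Proof.
  intros Hy.
  assert (Hlt : forall t, Rmin 0 y <= t <= Rmax 0 y -> t < 1 /\ t <= 1 / 2).
  { intros t Ht; assert (Rmax 0 y <= 1 / 2) by (apply Rmax_lub; lra); lra. }
  destruct (MVT_gen (log_remainder N) 0 y (fun t => t ^ S N / (1 - t)))
    as [c [Hc Heq]].
  - intros t Ht; apply is_derive_log_remainder, Hlt; lra.
  - intros t Ht; apply derivable_continuous_pt, ex_derive_Reals_0.
    eexists; apply is_derive_log_remainder, Hlt, Ht.
  - assert (H0 : log_remainder N 0 = 0).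
    { unfold log_remainder; rewrite Rminus_0_r, ln_1.
      rewrite (sum_n_ext _ (fun n => 0 * 0 ^ n)) by (intros n; simpl; unfold Rdiv; ring).
      rewrite sum_n_geometric by lra; field. }
    rewrite H0, !Rminus_0_r in Heq; rewrite Heq.
    destruct (Hlt c Hc) as [Hc1 Hc2].
    assert (Hcy : Rabs c <= Rabs y).
    { destruct (Rle_dec 0 y).
      - rewrite Rmin_left, Rmax_right in Hc by lra; rewrite !Rabs_pos_eq; lra.
      - rewrite Rmin_right, Rmax_left in Hc by lra; rewrite !Rabs_left1; lra. }
    unfold Rdiv; rewrite !Rabs_mult, <- RPow_abs, (Rabs_pos_eq (/ _))
      by (left; apply Rinv_0_lt_compat; lra).
    assert (Hi : / (1 - c) <= 2).
    { replace 2 with (/ (1 / 2)) by field; apply Rinv_le_contravar; lra. }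
    assert (Hp : Rabs c ^ S N <= Rabs y ^ S N)
      by (apply pow_incr; split; [apply Rabs_pos|exact Hcy]).
    assert (0 <= Rabs c ^ S N) by apply pow_le, Rabs_pos.
    assert (0 < / (1 - c)) by (apply Rinv_0_lt_compat; lra).
    replace (2 * Rabs y ^ S (S N)) with (Rabs y ^ S N * 2 * Rabs y) by (simpl; ring).
    apply Rmult_le_compat_r; [apply Rabs_pos|].
    apply Rmult_le_compat; lra.
Qed.

(* Landen's identity [- Li_2(-s) - Li_2(s / (1 + s)) = ln^2 (1 + s) / 2], with
   both dilogarithms truncated. *)
Definition landen_defect (N : nat) (s : R) : R :=
  sum_n (fun n => ((-1) ^ n * s ^ S n - (s / (1 + s)) ^ S n) / (INR n + 1) ^ 2) N
  - ln (1 + s) ^ 2 / 2.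

Definition landen_defect' (N : nat) (s : R) : R :=
  sum_n (fun n => ((-1) ^ n * s ^ n - (s / (1 + s)) ^ n / (1 + s) ^ 2)
                  / (INR n + 1)) N
  - ln (1 + s) / (1 + s).

Lemma is_derive_landen_defect (N : nat) (s : R) : 0 <= s ->
  is_derive (landen_defect N) s (landen_defect' N s).
Proof.
  intros Hs; unfold landen_defect, landen_defect'.
  apply (is_derive_minus (V := R_NormedModule)).
  - apply (is_derive_sum_n (V := R_NormedModule)
      (fun n s => ((-1) ^ n * s ^ S n - (s / (1 + s)) ^ S n) / (INR n + 1) ^ 2)).
    intros k _; pose proof (pos_INR k).
    apply is_derive_ext with
      (fun s => ((-1) ^ k * s ^ (k + 1) - (s / (1 + s)) ^ (k + 1)) / (INR k + 1) ^ 2).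
    { intros t; now replace (k + 1)%nat with (S k) by lia. }
    auto_derive; [lra|].
    replace (pred (k + 1)) with k by lia.
    rewrite plus_INR; simpl (INR 1).
    change (s * / (1 + s)) with (s / (1 + s)).
    set (P := (s / (1 + s)) ^ k); field; lra.
  - auto_derive; [lra|field; lra].
Qed.

(** The factor [s] turns both sums into truncated logarithm series, at [-s] and at [s / (1 + s)].
    The logarithms match because [1 - s / (1 + s) = 1 / (1 + s)] and
    [s / (1 + s) = 1 - 1 / (1 + s)]. *)
Lemma landen_defect'_eq (N : nat) (s : R) : 0 <= s ->
  s * landen_defect' N s
  = log_remainder N (- s) + log_remainder N (s / (1 + s)) / (1 + s).
Proof.
  intros Hs; unfold landen_defect', log_remainder.
  replace (1 - - s) with (1 + s) by ring.
  replace (1 - s / (1 + s)) with (/ (1 + s)) by (field; lra).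
  rewrite ln_Rinv by lra.
  induction N as [|N IH].
  - rewrite !sum_O; simpl; field; lra.
  - rewrite !sum_Sn; unfold plus; simpl (AbelianMonoid.plus _ _).
    match goal with |- s * (?a + ?b - ?c) = ?d =>
      transitivity (s * (a - c) + s * b); [ring|] end.
    rewrite IH.
    (* Both new terms are expressed through [(-1) ^ S N * s ^ S N] and [(s / (1 + s)) ^ S N], which
       [field] then treats as atoms. *)
    replace ((- s) ^ S (S N)) with ((-1) ^ S N * s ^ S N * - s)
      by (rewrite <- Rpow_mult_distr; simpl; replace (-1 * s) with (- s) by ring; ring).
    rewrite <- (tech_pow_Rmult (s / (1 + s)) (S N)).
    pose proof (pos_INR (S N)).
    set (A := sum_n _ N); set (B := sum_n _ N).
    set (X := (-1) ^ S N * s ^ S N); set (Y := (s / (1 + s)) ^ S N).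
    field; lra.
Qed.

(** Each of the two remainders is at most [2 * s ^ S (S N)], since [s / (1 + s) <= s]; dividing by
    [s] gives the bound. *)
Lemma landen_defect'_le (N : nat) (s : R) : 0 < s <= 1 ->
  Rabs (landen_defect' N s) <= 4 * s ^ S N.
Proof.
  intros Hs.
  assert (Ht : 0 <= s / (1 + s) <= s).
  { split; [apply Rdiv_le_0_compat; lra|].
    apply Rmult_le_reg_r with (1 + s); [lra|].
    unfold Rdiv; rewrite Rmult_assoc, Rinv_l by lra; nra. }
  assert (Ht2 : s / (1 + s) <= 1 / 2).
  { apply Rmult_le_reg_r with (1 + s); [lra|].
    unfold Rdiv at 1; rewrite Rmult_assoc, Rinv_l by lra; lra. }
  pose proof (log_remainder_le N (- s) ltac:(lra)) as H1.
  pose proof (log_remainder_le N (s / (1 + s)) ltac:(lra)) as H2.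
  rewrite Rabs_Ropp, (Rabs_pos_eq s) in H1 by lra.
  rewrite (Rabs_pos_eq (s / (1 + s))) in H2 by lra.
  assert (H3 : (s / (1 + s)) ^ S (S N) <= s ^ S (S N)) by (apply pow_incr; lra).
  apply Rmult_le_reg_l with s; [lra|].
  rewrite <- (Rabs_pos_eq s) at 1 by lra.
  rewrite <- Rabs_mult, landen_defect'_eq by lra.
  eapply Rle_trans; [apply Rabs_triang|].
  unfold Rdiv; rewrite Rabs_mult, (Rabs_pos_eq (/ _))
    by (left; apply Rinv_0_lt_compat; lra).
  assert (Hi : 0 < / (1 + s) <= 1).
  { split; [apply Rinv_0_lt_compat; lra|].
    rewrite <- Rinv_1; apply Rinv_le_contravar; lra. }
  pose proof (Rabs_pos (log_remainder N (s / (1 + s)))) as H4.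
  assert (Rabs (log_remainder N (s / (1 + s))) * / (1 + s)
          <= Rabs (log_remainder N (s / (1 + s)))) by nra.
  replace (s * (4 * s ^ S N)) with (4 * s ^ S (S N)) by (simpl; ring).
  unfold Rdiv in *; lra.
Qed.

(** The mean value theorem for [g - f] integrates a bound on derivatives. The inequality is asked
    only inside the interval, because the bound on [landen_defect'] is obtained by dividing by
    [s]. *)
Lemma MVT_dominated (f f' g g' : R -> R) :
  (forall s, 0 <= s <= 1 -> is_derive f s (f' s)) ->
  (forall s, 0 <= s <= 1 -> is_derive g s (g' s)) ->
  (forall s, 0 < s < 1 -> f' s <= g' s) ->
  f 1 - f 0 <= g 1 - g 0.
Proof.
  intros Hf Hg Hfg.
  destruct (MVT_cor2 (fun s => g s - f s) (fun s => g' s - f' s) 0 1)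
    as [c [Heq Hc]]; [lra| |].
  - intros s Hs; apply is_derive_Reals.
    apply (is_derive_minus (V := R_NormedModule)); auto.
  - specialize (Hfg c Hc); simpl in Heq; lra.
Qed.

(** The defect vanishes at 0 and is compared with [4 s^(N+2) / (N+2)] and its opposite, whose
    derivatives are the bounds on [landen_defect']. *)
Lemma landen_defect_le (N : nat) :
  Rabs (landen_defect N 1) <= 4 / (INR N + 2).
Proof.
  pose proof (pos_INR N) as HN.
  assert (Hg : forall a s, 0 <= s <= 1 ->
    is_derive (fun s => a * s ^ (N + 2) / (INR N + 2)) s (a * s ^ S N)).
  { intros a s _; auto_derive; trivial.
    replace (pred (N + 2)) with (S N) by lia.
    rewrite plus_INR; simpl (INR 2); field; lra. }
  assert (H0 : landen_defect N 0 = 0).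
  { unfold landen_defect; rewrite Rplus_0_r, ln_1.
    rewrite (sum_n_ext _ (fun n => 0 * 0 ^ n)).
    - rewrite sum_n_geometric by lra; field.
    - intros n; simpl; unfold Rdiv; ring. }
  assert (Hb : forall s, 0 < s < 1 -> Rabs (landen_defect' N s) <= 4 * s ^ S N)
    by (intros s Hs; apply landen_defect'_le; lra).
  apply Rabs_le; split.
  - pose proof (MVT_dominated _ _ _ _ (Hg (-4))
      (fun s Hs => is_derive_landen_defect N s (proj1 Hs))) as H.
    simpl in H; rewrite H0, pow1, pow_ne_zero in H by lia.
    enough (-4 * 1 / (INR N + 2) - -4 * 0 / (INR N + 2) <= landen_defect N 1 - 0)
      by (unfold Rdiv in *; lra).
    apply H; intros s Hs; specialize (Hb s Hs); apply Rabs_le_between in Hb.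
    simpl in Hb; lra.
  - pose proof (MVT_dominated _ _ _ _
      (fun s Hs => is_derive_landen_defect N s (proj1 Hs)) (Hg 4)) as H.
    simpl in H; rewrite H0, pow1, pow_ne_zero in H by lia.
    enough (landen_defect N 1 - 0 <= 4 * 1 / (INR N + 2) - 4 * 0 / (INR N + 2))
      by (unfold Rdiv in *; lra).
    apply H; intros s Hs; specialize (Hb s Hs); apply Rabs_le_between in Hb.
    simpl in Hb; lra.
Qed.

(** Landen's identity at [s = 1], where [s / (1 + s) = 1/2]: the two sums are truncations of eta(2)
    and [Li_2(1/2)]. *)
Lemma landen_half :
  is_lim_seq (fun N => sum_n (fun n => (-1) ^ n / (INR n + 1) ^ 2) N
                       - sum_n (fun n => / (2 ^ (n + 1) * (INR n + 1) ^ 2)) N)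
    (ln 2 ^ 2 / 2).
Proof.
  assert (Hdef : is_lim_seq (fun N => landen_defect N 1) 0).
  { apply is_lim_seq_abs_0.
    apply is_lim_seq_le_le with (u := fun _ => 0) (w := fun N => 4 * / (INR N + 1)).
    - intros N; split; [apply Rabs_pos|].
      eapply Rle_trans; [apply landen_defect_le|].
      pose proof (pos_INR N); apply Rmult_le_compat_l; [lra|].
      apply Rinv_le_contravar; lra.
    - apply is_lim_seq_const.
    - evar_last; [apply is_lim_seq_mult';
        [apply is_lim_seq_const|apply is_lim_seq_inv_INR_plus_1]|].
      simpl; f_equal; ring. }
  apply is_lim_seq_ext with (fun N => landen_defect N 1 + ln 2 ^ 2 / 2).
  - intros N; unfold landen_defect.
    replace (1 + 1) with 2 by ring.
    enough (H : sum_n (fun n => (-1) ^ n / (INR n + 1) ^ 2) N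
         - sum_n (fun n => / (2 ^ (n + 1) * (INR n + 1) ^ 2)) N
       = sum_n (fun n => ((-1) ^ n * 1 ^ S n - (1 / 2) ^ S n) / (INR n + 1) ^ 2) N)
      by (rewrite <- H; ring).
    assert (Ht : forall n, ((-1) ^ n * 1 ^ S n - (1 / 2) ^ S n) / (INR n + 1) ^ 2
      = (-1) ^ n / (INR n + 1) ^ 2 - / (2 ^ (n + 1) * (INR n + 1) ^ 2)).
    { intros n; pose proof (pos_INR n).
      replace (n + 1)%nat with (S n) by lia.
      replace (1 / 2) with (/ 2) by field.
      rewrite pow1, pow_inv.
      pose proof (pow_nonzero 2 (S n) ltac:(lra)); field; split; lra. }
    induction N as [|N IH].
    + rewrite !sum_O; symmetry; apply Ht.
    + rewrite !sum_Sn, <- IH, Ht; unfold plus; simpl (AbelianMonoid.plus _ _); ring.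
  - evar_last; [apply is_lim_seq_plus'; [exact Hdef|apply is_lim_seq_const]|].
    simpl; f_equal; ring.
Qed.

(** * Series expansions of the four integrals *)

Lemma log_integral_const (c : R) : log_integral (fun _ => c) = c.
Proof.
  rewrite (log_integral_ext _ (fun x => c * x ^ 0)) by (intros x _; simpl; ring).
  rewrite (log_integral_scal c (fun x => x ^ 0)), log_integral_pow.
  - simpl; field.
  - apply (continuous_on_unit_pow (fun x => x)); intros x _; apply continuous_id.
Qed.

Lemma log_integral_half_pow_lim :
  is_lim_seq (fun n => log_integral (fun _ => (1 / 2) ^ n)) 0.
Proof.
  apply is_lim_seq_ext with (fun n => (1 / 2) ^ n).
  - intros n; now rewrite log_integral_const.
  - apply is_lim_seq_geom; rewrite Rabs_pos_eq; lra.
Qed.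

(** The dominating function [x ^ 2] reaches 1 at the endpoint, so the decay comes from the moment
    [1 / (2n+1)^2]. *)
Lemma log_integral_sqr_pow_lim :
  is_lim_seq (fun n => log_integral (fun x => (x ^ 2) ^ n)) 0.
Proof.
  apply is_lim_seq_le_le with (u := fun _ => 0) (w := fun n => / (INR n + 1)).
  - intros n.
    rewrite (log_integral_ext _ (fun x => x ^ (2 * n)))
      by (intros x _; symmetry; apply pow_mult).
    rewrite log_integral_pow, mult_INR; simpl (INR 2).
    pose proof (pos_INR n); split.
    + left; apply Rinv_0_lt_compat, pow_lt; lra.
    + apply Rinv_le_contravar; nra.
  - apply is_lim_seq_const.
  - apply is_lim_seq_inv_INR_plus_1.
Qed.

(* [is_series_ext] with the equation stated in [R], where [field] applies,
   rather than in the carrier of a normed module. *)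
Lemma is_series_ext_R (a b : nat -> R) (l : R) :
  (forall n, a n = b n) -> is_series a l -> is_series b l.
Proof. exact (is_series_ext a b l). Qed.

Lemma dilog_half_series :
  is_series (fun n => / (2 ^ (n + 1) * (INR n + 1) ^ 2))
    (log_integral (fun x => 1 / 2 / (1 - x / 2))).
Proof.
  eapply is_series_ext_R.
  2: { apply (is_series_log_integral_geometric
         (fun _ => 1 / 2) (fun x => x / 2) (fun _ => 1 / 2)).
       1-3: apply continuous_on_unit_ex_derive; intros x _; auto_derive; trivial.
       - intros x Hx; lra.
       - intros x Hx; rewrite Rabs_pos_eq.
         + apply Rle_div_l; lra.
         + apply Rdiv_le_0_compat; lra.
       - intros x Hx; rewrite Rabs_pos_eq; lra.
       - apply log_integral_half_pow_lim. }
  intros n; cbv beta.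
  rewrite (log_integral_ext _ (fun x => / 2 ^ (n + 1) * x ^ n)).
  - rewrite (log_integral_scal _ (fun x => x ^ n)), log_integral_pow.
    + rewrite Rinv_mult; reflexivity.
    + apply (continuous_on_unit_pow (fun x => x)); intros x _; apply continuous_id.
  - intros x _; unfold Rdiv.
    rewrite Rpow_mult_distr, pow_inv, pow_add.
    pose proof (pow_nonzero 2 n ltac:(lra)); field; assumption.
Qed.

(** The expansion has the odd powers [x ^ (2 * n + 1)], with moments [1 / (2n+2)^2]; this is the
    source of the factor [1 / 4]. *)
Lemma eta_even_series :
  is_series (fun n => 1 / 4 * ((-1) ^ n / (INR n + 1) ^ 2))
    (log_integral (fun x => x / (1 - - x ^ 2))).
Proof.
  eapply is_series_ext_R.
  2: { apply (is_series_log_integral_geometric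
         (fun x => x) (fun x => - x ^ 2) (fun x => x ^ 2)).
       1-3: apply continuous_on_unit_ex_derive; intros x _; auto_derive; trivial.
       - intros x Hx; nra.
       - intros x Hx; rewrite Rabs_pos_eq.
         + apply Rle_div_l; nra.
         + apply Rdiv_le_0_compat; nra.
       - intros x Hx; rewrite Rabs_Ropp, Rabs_pos_eq; nra.
       - apply log_integral_sqr_pow_lim. }
  intros n; cbv beta.
  rewrite (log_integral_ext _ (fun x => (-1) ^ n * x ^ (2 * n + 1))).
  - rewrite (log_integral_scal _ (fun x => x ^ (2 * n + 1))), log_integral_pow.
    + rewrite plus_INR, mult_INR; simpl (INR 2); simpl (INR 1).
      pose proof (pos_INR n); field; lra.
    + apply (continuous_on_unit_pow (fun x => x)); intros x _; apply continuous_id.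
  - intros x _; rewrite pow_add, pow_mult.
    replace (- x ^ 2) with (-1 * x ^ 2) by ring.
    rewrite Rpow_mult_distr; ring.
Qed.

Lemma catalan_series :
  is_series (fun n => (-1) ^ n / (1 + 2 * INR n) ^ 2)
    (log_integral (fun x => 1 / (1 - - x ^ 2))).
Proof.
  eapply is_series_ext_R.
  2: { apply (is_series_log_integral_geometric
         (fun _ => 1) (fun x => - x ^ 2) (fun x => x ^ 2)).
       1-3: apply continuous_on_unit_ex_derive; intros x _; auto_derive; trivial.
       - intros x Hx; nra.
       - intros x Hx; rewrite Rabs_pos_eq.
         + apply Rle_div_l; nra.
         + apply Rdiv_le_0_compat; nra.
       - intros x Hx; rewrite Rabs_Ropp, Rabs_pos_eq; nra.
       - apply log_integral_sqr_pow_lim. }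
  intros n; cbv beta.
  rewrite (log_integral_ext _ (fun x => (-1) ^ n * x ^ (2 * n))).
  - rewrite (log_integral_scal _ (fun x => x ^ (2 * n))), log_integral_pow.
    + rewrite mult_INR; simpl (INR 2).
      pose proof (pos_INR n); field; lra.
    + apply (continuous_on_unit_pow (fun x => x)); intros x _; apply continuous_id.
  - intros x _; rewrite pow_mult.
    replace (- x ^ 2) with (-1 * x ^ 2) by ring.
    rewrite Rpow_mult_distr; ring.
Qed.

(** The Beta formula with exponents [k] and [2k] has coefficient [k! (2k)! / (3k+1)!], the inverse
    of [(3k+1) C(3k,k)]. The power [2 ^ (k + 1)] collects the factor [1 / 2] and the ratio's [k]
    halves. *)
Lemma harmonic_binomial_series :
  is_series
    (fun k : nat =>
       (harmonic (3 * k + 1) - harmonic k)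
       / ((3 * INR k + 1) * Binomial.C (3 * k) k * 2 ^ (k + 1)))
    (log_integral (fun x => 1 / 2 / (1 - x * (1 - x) ^ 2 / 2))).
Proof.
  (* The crude bound [x (1-x)^2 <= 1] already gives a constant ratio [1 / 2] for domination. *)
  assert (Hr : forall x, 0 <= x <= 1 -> 0 <= x * (1 - x) ^ 2 / 2 <= 1 / 2).
  { intros x Hx; assert (0 <= (1 - x) ^ 2 <= 1) by nra; nra. }
  eapply is_series_ext_R.
  2: { apply (is_series_log_integral_geometric
         (fun _ => 1 / 2) (fun x => x * (1 - x) ^ 2 / 2) (fun _ => 1 / 2)).
       1-3: apply continuous_on_unit_ex_derive; intros x _; auto_derive; trivial.
       - intros x Hx; specialize (Hr x Hx); lra.
       - intros x Hx; specialize (Hr x Hx); rewrite Rabs_pos_eq.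
         + apply Rle_div_l; lra.
         + apply Rdiv_le_0_compat; lra.
       - intros x Hx; specialize (Hr x Hx); rewrite Rabs_pos_eq; lra.
       - apply log_integral_half_pow_lim. }
  intros n; cbv beta.
  rewrite (log_integral_ext _
    (fun x => / 2 ^ (n + 1) * (x ^ n * (1 - x) ^ (2 * n)))).
  - rewrite (log_integral_scal _ (fun x => x ^ n * (1 - x) ^ (2 * n))), log_integral_beta.
    + unfold Binomial.C.
      replace (3 * n - n)%nat with (2 * n)%nat by lia.
      replace (n + 2 * n + 1)%nat with (S (3 * n)) by lia.
      replace (3 * n + 1)%nat with (S (3 * n)) by lia.
      rewrite fact_simpl, mult_INR, S_INR, mult_INR.
      replace (INR 3) with 3 by (simpl; ring).
      pose proof (INR_fact_neq_0 (3 * n)); pose proof (INR_fact_neq_0 (2 * n)).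
      pose proof (INR_fact_neq_0 n); pose proof (pos_INR n).
      pose proof (pow_nonzero 2 (n + 1) ltac:(lra)).
      set (a := INR (fact (3 * n))) in *; set (b := INR (fact (2 * n))) in *.
      set (c := INR (fact n)) in *; set (p := 2 ^ (n + 1)) in *.
      field; repeat split; (assumption || lra).
    + apply continuous_on_unit_ex_derive; intros x _; auto_derive; trivial.
  - intros x _; unfold Rdiv.
    rewrite !Rpow_mult_distr, pow_inv, pow_add, pow_mult.
    pose proof (pow_nonzero 2 n ltac:(lra)); field; assumption.
Qed.

(** * Partial fractions and evaluation *)

Lemma log_integral_partial_fractions :
  log_integral (fun x => 1 / 2 / (1 - x * (1 - x) ^ 2 / 2))
  = 1 / 5 * log_integral (fun x => 1 / 2 / (1 - x / 2))
    + (1 / 5 * log_integral (fun x => x / (1 - - x ^ 2))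
       + 2 / 5 * log_integral (fun x => 1 / (1 - - x ^ 2))).
Proof.
  assert (H1 : continuous_on_unit (fun x => 1 / 2 / (1 - x / 2))).
  { apply continuous_on_unit_ex_derive; intros x Hx; auto_derive; lra. }
  assert (H2 : continuous_on_unit (fun x => x / (1 - - x ^ 2))).
  { apply continuous_on_unit_ex_derive; intros x Hx; auto_derive; nra. }
  assert (H3 : continuous_on_unit (fun x => 1 / (1 - - x ^ 2))).
  { apply continuous_on_unit_ex_derive; intros x Hx; auto_derive; nra. }
  assert (Hs : forall a f, continuous_on_unit f -> continuous_on_unit (fun x => a * f x)).
  { intros a f Hf; apply continuous_on_unit_mult;
      [apply continuous_on_unit_const|exact Hf]. }
  rewrite <- !log_integral_scal by assumption.
  rewrite <- log_integral_plus by auto.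
  rewrite <- log_integral_plus by (try apply continuous_on_unit_plus; auto).
  apply log_integral_ext; intros x Hx.
  (* The coefficients come from [(1 + x^2) + (x + 2) (2 - x) = 5]. *)
  replace (1 - x * (1 - x) ^ 2 / 2) with ((2 - x) * (1 + x ^ 2) / 2) by field.
  field; repeat split; nra.
Qed.

Lemma is_lim_seq_finite_unique (u : nat -> R) (l l' : R) :
  is_lim_seq u l -> is_lim_seq u l' -> l = l'.
Proof.
  intros H H'; apply is_lim_seq_unique in H; apply is_lim_seq_unique in H'.
  rewrite H in H'; now injection H'.
Qed.

Theorem proposition1 :
  is_series
    (fun k : nat =>
       (harmonic (3 * k + 1) - harmonic k)
       / ((3 * INR k + 1) * Binomial.C (3 * k) k * 2 ^ (k + 1)))
    (PI ^ 2 / 48 - (ln 2) ^ 2 / 10 + 2 / 5 * Catalan).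
Proof.
  set (D := log_integral (fun x => 1 / 2 / (1 - x / 2))).
  set (E := log_integral (fun x => x / (1 - - x ^ 2))).
  assert (HC : Catalan = log_integral (fun x => 1 / (1 - - x ^ 2)))
    by apply is_series_unique, catalan_series.
  (* The integral [E] supplies convergence of the whole alternating series; its value is then read
     off along the odd indices, where [eta_2] computes it. *)
  assert (Heta : is_lim_seq (sum_n (fun n => (-1) ^ n / (INR n + 1) ^ 2)) (4 * E)).
  { apply is_lim_seq_ext with
      (fun N => 4 * sum_n (fun n => 1 / 4 * ((-1) ^ n / (INR n + 1) ^ 2)) N).
    - intros N; induction N as [|N IH].
      + rewrite !sum_O; simpl; field.
      + rewrite !sum_Sn, <- IH; unfold plus; simpl (AbelianMonoid.plus _ _).
        pose proof (pos_INR (S N)); set (X := (-1) ^ S N); field; lra.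
    - apply is_lim_seq_mult'; [apply is_lim_seq_const|exact eta_even_series]. }
  assert (HE : 4 * E = PI ^ 2 / 12).
  { assert (Hsub : is_lim_seq (fun N =>
      sum_n (fun n => (-1) ^ n / (INR n + 1) ^ 2) (2 * N + 1)) (4 * E)).
    { apply (is_lim_seq_subseq _ _ (fun N => (2 * N + 1)%nat)); [|exact Heta].
      apply eventually_subseq; intros n; lia. }
    exact (is_lim_seq_finite_unique _ _ _ Hsub eta_2). }
  assert (HD : 4 * E - D = ln 2 ^ 2 / 2).
  { pose proof (is_lim_seq_minus' _ _ _ _ Heta dilog_half_series) as Hl.
    exact (is_lim_seq_finite_unique _ _ _ Hl landen_half). }
  replace (PI ^ 2 / 48 - ln 2 ^ 2 / 10 + 2 / 5 * Catalan)
    with (log_integral (fun x => 1 / 2 / (1 - x * (1 - x) ^ 2 / 2))).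
  - exact harmonic_binomial_series.
  - rewrite log_integral_partial_fractions, <- HC.
    (* Here [D = 4 E - ln^2 2 / 2] and [E = PI^2 / 48], so [(D + E) / 5 = E - ln^2 2 / 10]. *)
    fold D; fold E; lra.
Qed.
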